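(* Let $(X,d)$ be a nonempty separable metric space in which all balls $D(x,r):=\{y: d(x,y)<r\}$ are relatively compact, let $\mu$ be a positive Radon measure on $X$ with full support, and let $(x,y,t)\mapsto p_t(x,y)\in[0,\infty)$ be a continuous function on $X\times X\times(0,\infty)$ such that: (CK) $p_{s+t}(x,y)=\int p_s(x,z)p_t(z,y)\,d\mu(z)$ for all $s,t>0$, $x,y\in X$; (E) $\sup_{t>0}\int p_t(x,y)\,d\mu(y)=1$ for every $x\in X$; (B) there are constants $\alpha,\beta>0$ and decreasing functions $\Phi_1,\Phi_2\colon[0,\infty)\to[0,\infty)$ with $\Phi_1(1)>0$, $\int_0^\infty\sigma^{\alpha-1}\Phi_2(\sigma)\,d\sigma<\infty$ and $$t^{-\alpha/\beta}\Phi_1\big(d(x,y)t^{-1/\beta}\big)\le p_t(x,y)\le t^{-\alpha/\beta}\Phi_2\big(d(x,y)t^{-1/\beta}\big)\quad\text{for all }x,y\in X,\ t>0.$$ Let $X':=X\times\mathbb R$. Then there exists $C>0$ such that, for all $x'\in X'$ and $\rho>0$, $$B(x',\rho)\subset Z_\beta\big(x',(C\rho)^{1/\alpha}\big).$$ In particular, $m_{\alpha,\beta}\le C\,m_{G'}$.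
   Context: $G'\colon X'\times X'\to[0,\infty)$ is given by $G'((x,r),(y,s)):=p_{r-s}(x,y)$ if $r>s$ and $:=0$ if $r\le s$. $B(x',\rho):=\{y'\in X': G'(x',y')>1/\rho\}$ and, for $A\subset X'$, $$m_{G'}(A):=\lim_{\delta\to0}\inf\Big\{\sum_{j=1}^\infty\rho_j:\ A\subset\bigcup_{j=1}^\infty B(x_j',\rho_j),\ x_j'\in X',\ 0<\rho_j<\delta\Big\}.$$ $Z_\beta((x,r),\rho):=\{(y,s)\in X': d(x,y)<\rho\text{ and }|r-s|<\rho^\beta\}$ and, for $A\subset X'$, $$m_{\alpha,\beta}(A):=\lim_{\delta\to0}\inf\Big\{\sum_{j=1}^\infty\rho_j^\alpha:\ A\subset\bigcup_{j=1}^\infty Z_\beta(x_j',\rho_j),\ x_j'\in X',\ 0<\rho_j<\delta\Big\}.$$ *)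

(* Defs.v *)
From HB Require Import structures.
From mathcomp Require Import all_boot all_order all_algebra.
From mathcomp Require Import all_classical all_reals all_analysis.

Set Implicit Arguments.
Unset Strict Implicit.
Unset Printing Implicit Defensive.

Import Order.TTheory GRing.Theory Num.Theory.
Import numFieldNormedType.Exports.

Local Open Scope classical_set_scope.
Local Open Scope ring_scope.

(* The distinguished point only records nonemptiness; it is also what
   [g_sigma_algebraType] requires of its carrier. *)
#[short(type="pmetricType")]
HB.structure Definition PMetric (K : numDomainType) :=
  { M of Metric K M & Pointed M }.

Notation borelType X := (g_sigma_algebraType (@open X)).

Definition separable (X : topologicalType) : Prop :=
  exists2 S : set X, countable S & dense S.

(* Finite on compact sets and inner regular on Borel sets. *)
Definition radon_measure (R : realType) (X : pmetricType R)
    (mu : {measure set (borelType X) -> \bar R}) : Prop :=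
  (forall K : set X, compact K -> (mu K < +oo)%E) /\
  (forall A : set (borelType X), measurable A ->
     mu A = ereal_sup [set mu K | K in [set K : set X | compact K /\ K `<=` A]]).

Definition full_support (R : realType) (X : pmetricType R)
    (mu : {measure set (borelType X) -> \bar R}) : Prop :=
  forall U : set X, open U -> U !=set0 -> (0 < mu U)%E.

Section space_time.
Context (R : realType) (X : pmetricType R).

Definition Gprime (p : R -> X -> X -> R) (x' y' : X * R) : R :=
  if y'.2 < x'.2 then p (x'.2 - y'.2) x'.1 y'.1 else 0.

Definition Gball (p : R -> X -> X -> R) (x' : X * R) (rho : R) : set (X * R) :=
  [set y' | rho^-1 < Gprime p x' y'].

Definition Zball (beta : R) (x' : X * R) (rho : R) : set (X * R) :=
  [set y' | mdist x'.1 y'.1 < rho /\ `|x'.2 - y'.2| < rho `^ beta].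

End space_time.

(* Covering construction from "balls" [V x rho] of weight [h rho]: the infimum
   is [+oo] when there is no admissible countable covering. *)
Definition cover_content (R : realType) (T : Type) (V : T -> R -> set T)
    (h : R -> R) (delta : R) (A : set T) : \bar R :=
  ereal_inf [set s | exists (c : nat -> T) (rho : nat -> R),
    [/\ forall j, 0 < rho j < delta,
        A `<=` \bigcup_j V (c j) (rho j) &
        s = (\sum_(0 <= j <oo) (h (rho j))%:E)%E]].

Definition cover_measure (R : realType) (T : Type) (V : T -> R -> set T)
    (h : R -> R) (A : set T) : \bar R :=
  lim (cover_content V h delta A @[delta --> 0^'+]).

Definition mG (R : realType) (X : pmetricType R) (p : R -> X -> X -> R) :
    set (X * R) -> \bar R :=
  cover_measure (Gball p) id.

Definition mZ (R : realType) (X : pmetricType R) (alpha beta : R) :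
    set (X * R) -> \bar R :=
  cover_measure (@Zball R X beta) (fun rho => rho `^ alpha).

(* Main.v *)
Require Import Defs.
From mathcomp Require Import all_boot all_order all_algebra.
From mathcomp Require Import all_classical all_reals all_analysis.
From mathcomp Require Import ring.
Import Order.TTheory GRing.Theory Num.Theory.
Import numFieldNormedType.Exports.
Local Open Scope classical_set_scope.
Local Open Scope ring_scope.

(* With [t = r - s] and [u = d(x, y) t^(-1/beta)], membership in [Gball] and the
   upper bound give [t^(alpha/beta) < rho * Phi2 u]. Boundedness of [Phi2]
   controls [t], and boundedness of [u^alpha * Phi2 u], which the integral
   condition provides, controls [d(x, y)^alpha = u^alpha * t^(alpha/beta)]. *)

(* [ge0_le_integral] asks both functions to be measurable; monotonicity holds
   without it because the integral is a supremum over simple functions. *)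
Lemma ge0_le_integral_nonmeasurable d (T : measurableType d) (R : realType)
    (mu : {measure set T -> \bar R}) (D : set T) (f g : T -> \bar R) :
  (forall x, D x -> (0 <= f x)%E) -> (forall x, D x -> (f x <= g x)%E) ->
  (\int[mu]_(x in D) f x <= \int[mu]_(x in D) g x)%E.
Proof.
move=> f0 fg; rewrite !(integral_mkcond D) !ge0_integralTE.
- apply: ereal_sup_le => _ [h hf <-]; exists h => // x.
  exact: (le_trans (hf x) (lee_restrict fg x)).
- by apply: erestrict_ge0 => x Dx; exact: (le_trans (f0 _ Dx) (fg _ Dx)).
- exact: erestrict_ge0.
Qed.

(* On [u / 2, u] one has [s `^ (a - 1) = s `^ a / s >= (u / 2) `^ a / u], so the
   integral over this segment already controls the product. *)
Lemma powR_mul_le_integral (R : realType) (a u : R) (Phi : R -> R) :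
  0 < a -> 0 < u ->
  (forall s : R, 0 <= s -> 0 <= Phi s) ->
  (forall s t : R, 0 <= s -> s <= t -> Phi t <= Phi s) ->
  ((u `^ a * Phi u)%:E <= (2 `^ a * 2)%:E *
    \int[lebesgue_measure]_(s in `]0%R, +oo[) (s `^ (a - 1) * Phi s)%:E)%E.
Proof.
move=> a0 u0 Phi0 Phidecr.
have u20 : 0 < u / 2 by rewrite divr_gt0.
have u2u : u / 2 < u by rewrite ltr_pdivrMr// ltr_pMr// ltr1n.
pose c := (u / 2) `^ a / u * Phi u.
have c0 : 0 <= c.
  by rewrite mulr_ge0// ?Phi0 ?(ltW u0)// divr_ge0 ?powR_ge0 ?(ltW u0).
(* The factor [2 ^ a * 2] is exact: the segment has length [u / 2], so [c] times it is
   [(u / 2) ^ a * Phi u / 2]. *)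
have -> : (u `^ a * Phi u)%:E = ((2 `^ a * 2)%:E * (c%:E * (u - u / 2)%:E))%E.
  rewrite -!EFinM; congr EFin; rewrite /c.
  have -> : u `^ a = 2 `^ a * (u / 2) `^ a.
    by rewrite -powRM ?(ltW u20)// mulrC divfK.
  have -> : u - u / 2 = u / 2 by rewrite {1}[u](splitr u) addrK.
  by field; rewrite gt_eqF.
rewrite lee_pmul2l//.
pose A : set R := [set` `[u / 2, u]].
(* The product is the integral of the step function equal to [c] on [A] and to 0 elsewhere, which
   lies below the integrand. *)
have <- : (\int[lebesgue_measure]_(s in `]0%R, +oo[)
    (cst c%:E \_ A) s)%E = (c%:E * (u - u / 2)%:E)%E.
  rewrite -integral_mkcondr setIidr; last first.
    move=> s /=; rewrite !in_itv/= andbT => /andP[us _].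
    exact: (lt_le_trans u20 us).
  rewrite integral_cst; last exact: measurable_itv.
  congr (_ * _)%E; have /= := lebesgue_measure_itv `[u / 2, u].
  by rewrite lte_fin u2u.
apply: ge0_le_integral_nonmeasurable => s.
  by move=> _; apply: erestrict_ge0 => x _; rewrite /= lee_fin.
rewrite /= in_itv/= andbT => s0; rewrite patchE; case: ifPn => [|_]; last first.
  by rewrite lee_fin mulr_ge0 ?powR_ge0 ?Phi0 ?ltW.
rewrite inE /A/= in_itv/= lee_fin => /andP[us su].
rewrite /c ler_pM ?Phi0 ?Phidecr ?(ltW s0) ?(ltW u0)//.
  by rewrite divr_ge0 ?powR_ge0 ?ltW.
have -> : s `^ (a - 1) = s `^ a / s.
  by rewrite -(mulr_powRB1 (ltW s0) a0) mulrAC divff ?mul1r// gt_eqF.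
rewrite ler_pM ?powR_ge0 ?invr_ge0 ?(ltW u0)//.
  by rewrite ge0_ler_powR ?nnegrE ?(ltW a0) ?(ltW s0) ?(ltW u20).
by rewrite lef_pV2.
Qed.

Section cover_measure.
Context (R : realType) (T : Type).
Implicit Types (V W : T -> R -> set T) (g h : R -> R) (A : set T).

Lemma cover_content_nonincreasing V h A (d e : R) :
  d <= e -> (cover_content V h e A <= cover_content V h d A)%E.
Proof.
move=> de; apply: le_ereal_inf_tmp => _ [c [r [r_lt AV ->]]].
apply: ereal_inf_lbound; exists c, r; split => // j.
by have /andP[-> /lt_le_trans ->] := r_lt j.
Qed.

(** Shrinking [delta] leaves fewer admissible coverings, so the contents increase as [delta]
    decreases to 0 and their limit is a supremum. *)
Lemma cover_measureE V h A : cover_measure V h A =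
  ereal_sup [set cover_content V h d A | d in [set d | 0 < d]].
Proof.
rewrite /cover_measure; apply/cvg_lim => //.
have -> : [set d : R | 0 < d] = [set` Interval (BRight 0) (BInfty R false)].
  by apply/seteqP; split => d /=; rewrite in_itv/= andbT.
apply: nonincreasing_at_right_cvge => // d e _ _.
exact: cover_content_nonincreasing.
Qed.

(** Replacing each [V x r] by [W x (f r)] keeps a covering a covering and multiplies its total
    weight by [C]. As [f] tends to 0 at [0^'+], the new radii stay below any prescribed bound once
    the old ones are small. *)
Lemma cover_measure_le V W g h (f : R -> R) (C : R) A :
  0 < C -> (forall r : R, 0 < r -> 0 <= h r) ->
  (forall x (r : R), 0 < r -> V x r `<=` W x (f r)) ->
  (forall r : R, 0 < r -> 0 < f r) -> (forall r : R, 0 < r -> g (f r) = C * h r) ->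
  f r @[r --> 0^'+] --> 0 ->
  (cover_measure W g A <= C%:E * cover_measure V h A)%E.
Proof.
move=> C0 h0 VW f0 gf fcvg; rewrite !cover_measureE.
apply: ge_ereal_sup => _ [e /= e0 <-].
have [d /= d0 fd] : exists2 d : R, 0 < d & forall r, 0 < r < d -> f r < e.
  have /(_ _ e e0) := @cvgr_lt _ _ _ _ _ _ fcvg.
  move=> [d d0 fd]; exists d => // r /andP[r0 rd]; apply: fd => //=.
  by rewrite sub0r normrN gtr0_norm.
apply: (@le_trans _ _ (C%:E * cover_content V h d A)%E); last first.
  by rewrite lee_pmul2l//; apply: ereal_sup_ubound; exists d.
rewrite -ereal_inf_pZl//; apply: le_ereal_inf_tmp => _ [_ [c [r [rd AV ->]]] <-].
apply: ereal_inf_lbound; exists c, (f \o r); split => [j /=|x /AV[j _ Vx]|/=].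
- by rewrite f0 ?fd//; have /andP[] := rd j.
- by exists j => //=; apply: VW Vx; have /andP[] := rd j.
- rewrite -nneseriesZl; last first.
    by move=> j _; rewrite lee_fin h0//; have /andP[] := rd j.
  by apply: eq_eseriesr => j _; rewrite gf ?EFinM//; have /andP[] := rd j.
Qed.

End cover_measure.

Lemma Gball_sub_Zball (R : realType) (X : pmetricType R) (p : R -> X -> X -> R)
    (alpha beta C rho : R) (Phi : R -> R) (x' : X * R) :
  0 < alpha -> 0 < beta -> 0 < C -> 0 < rho ->
  (forall s : R, 0 <= s -> 0 <= Phi s <= C) ->
  (forall s : R, 0 <= s -> s `^ alpha * Phi s <= C) ->
  (forall t x y, 0 < t ->
    p t x y <= t `^ (- (alpha / beta)) * Phi (mdist x y * t `^ (- beta^-1))) ->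
  Gball p x' rho `<=` Zball beta x' ((C * rho) `^ alpha^-1).
Proof.
move=> alpha0 beta0 C0 rho0 PhiC sPhiC B [y s]; case: x' => x r.
(* For [r <= s] the kernel is 0, which cannot exceed [rho^-1]. *)
rewrite /Gball /Zball /Gprime /=; case: ifPn => [sr|_]; last first.
  by rewrite ltNge invr_ge0 (ltW rho0).
have t0 : 0 < r - s by rewrite subr_gt0.
rewrite (gtr0_norm t0); move: (r - s) t0 => t t0 /lt_le_trans/(_ (B _ _ _ t0)).
set u := mdist x y * _ => Bt.
have u0 : 0 <= u by rewrite mulr_ge0 ?mdist_ge0 ?powR_ge0.
have Crho0 : 0 <= C * rho by rewrite mulr_ge0 ?ltW.
have ltPhi : t `^ (alpha / beta) < rho * Phi u.
  move: Bt; rewrite powRN [_ * Phi u]mulrC ltr_pdivlMr ?powR_gt0//.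
  by rewrite ltr_pdivrMl.
have Phiu0 : 0 < Phi u by rewrite -(pmulr_rgt0 _ rho0) (le_lt_trans _ ltPhi) ?powR_ge0.
have [_ PhiuC] := andP (PhiC u u0).
(* Both conditions of [Zball] reduce to this one, with [z] the distance or [t ^ (1 / beta)]. *)
have root_lt z : 0 <= z -> z `^ alpha < C * rho -> z < (C * rho) `^ alpha^-1.
  move=> z0 zC; have -> : z = (z `^ alpha) `^ alpha^-1.
    by rewrite -powRrM divff ?gt_eqF// powRr1.
  by rewrite gt0_ltr_powR ?invr_gt0 ?nnegrE ?powR_ge0.
split.
- apply: root_lt; rewrite ?mdist_ge0//.
  have -> : mdist x y = u * t `^ beta^-1.
    by rewrite /u powRN divfK// gt_eqF ?powR_gt0.
  rewrite powRM ?powR_ge0// -powRrM [_^-1 * _]mulrC.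
  (* Multiplying [ltPhi] by [u ^ alpha] keeps it strict only for [u > 0]; for [u = 0] the distance
     vanishes and [C * rho > 0] suffices. *)
  have [u_eq0|/negPf uN0] := eqVneq u 0.
    by rewrite u_eq0 powR0 ?gt_eqF// mul0r mulr_gt0.
  have ua0 : 0 < u `^ alpha by rewrite powR_gt0// lt_def uN0.
  apply: (@lt_le_trans _ _ (u `^ alpha * (rho * Phi u))); first by rewrite ltr_pM2l.
  by rewrite mulrCA mulrC ler_pM2r// sPhiC.
- have -> : t = (t `^ beta^-1) `^ beta.
    by rewrite -powRrM mulVf ?gt_eqF// powRr1 ?ltW.
  rewrite gt0_ltr_powR ?nnegrE ?powR_ge0//; apply: root_lt; rewrite ?powR_ge0//.
  rewrite -powRrM mulrC (lt_le_trans ltPhi)// mulrC.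
  by rewrite ler_pM2r.
Qed.

Theorem proposition7p6 (R : realType) (X : pmetricType R)
    (mu : {measure set (borelType X) -> \bar R})
    (p : R -> X -> X -> R) (alpha beta : R) (Phi1 Phi2 : R -> R)
    (X_separable : separable X)
    (X_balls : forall (x : X) (r : R), precompact [set y : X | mdist x y < r])
    (mu_radon : radon_measure mu)
    (mu_support : full_support mu)
    (p_ge0 : forall (t : R) (x y : X), 0 < t -> 0 <= p t x y)
    (p_continuous : {within [set q : X * X * R | 0 < q.2],
       continuous (fun q : X * X * R => p q.2 q.1.1 q.1.2)})
    (CK : forall (s t : R) (x y : X), 0 < s -> 0 < t ->
       (p (s + t) x y)%:E = (\int[mu]_z (p s x z * p t z y)%:E)%E)
    (E : forall x : X,
       ereal_sup [set (\int[mu]_y (p t x y)%:E)%E | t in [set t : R | 0 < t]]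
         = 1%E)
    (alpha_gt0 : 0 < alpha) (beta_gt0 : 0 < beta)
    (Phi1_ge0 : forall u : R, 0 <= u -> 0 <= Phi1 u)
    (Phi2_ge0 : forall u : R, 0 <= u -> 0 <= Phi2 u)
    (Phi1_decr : forall u v : R, 0 <= u -> u <= v -> Phi1 v <= Phi1 u)
    (Phi2_decr : forall u v : R, 0 <= u -> u <= v -> Phi2 v <= Phi2 u)
    (Phi1_1 : 0 < Phi1 1)
    (Phi2_int : (\int[lebesgue_measure]_(u in `]0%R, +oo[)
       (u `^ (alpha - 1) * Phi2 u)%:E < +oo)%E)
    (B : forall (t : R) (x y : X), 0 < t ->
       t `^ (- (alpha / beta)) * Phi1 (mdist x y * t `^ (- beta^-1)) <= p t x y
       /\ p t x y <=
         t `^ (- (alpha / beta)) * Phi2 (mdist x y * t `^ (- beta^-1))) :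
  exists C : R, [/\ 0 < C,
    forall (x' : X * R) (rho : R), 0 < rho ->
      Gball p x' rho `<=` Zball beta x' ((C * rho) `^ alpha^-1) &
    forall A : set (X * R), (mZ alpha beta A <= C%:E * mG p A)%E].
Proof.
pose I := (\int[lebesgue_measure]_(u in `]0%R, +oo[)
  (u `^ (alpha - 1) * Phi2 u)%:E)%E.
have I0 : (0 <= I)%E.
  apply: integral_ge0 => u; rewrite /= in_itv/= andbT => u0.
  by rewrite lee_fin mulr_ge0 ?powR_ge0 ?Phi2_ge0 ?ltW.
have Ifin : I \is a fin_num by rewrite ge0_fin_numE.
have K0 : 0 <= 2 `^ alpha * 2 * fine I.
  by rewrite mulr_ge0 ?fine_ge0// mulr_ge0 ?powR_ge0.
have P0 := Phi2_ge0 _ (lexx 0).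
(* The first term bounds [Phi2], the second bounds [s ^ alpha * Phi2 s], and 1 makes [C]
   positive. *)
pose C := Phi2 0 + 2 `^ alpha * 2 * fine I + 1.
have C0 : 0 < C by rewrite ltr_wpDl// addr_ge0.
have sub (x' : X * R) rho : 0 < rho ->
    Gball p x' rho `<=` Zball beta x' ((C * rho) `^ alpha^-1).
  move=> rho0; apply: (@Gball_sub_Zball _ _ _ _ _ _ _ Phi2) => //.
  - move=> s s0; rewrite Phi2_ge0//= (le_trans (Phi2_decr 0 s _ s0))//.
    by rewrite /C -addrA lerDl addr_ge0.
  - move=> s; rewrite le_eqVlt => /predU1P[<-|s0].
      by rewrite powR0 ?gt_eqF// mul0r ltW.
    apply: (@le_trans _ _ (2 `^ alpha * 2 * fine I)); last first.
      by rewrite /C addrAC lerDr addr_ge0.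
    rewrite -lee_fin [in leRHS]EFinM fineK//.
    exact: powR_mul_le_integral.
  - by move=> t x y /B-/(_ x y)[].
exists C; split => // A.
(* This radius map turns the weight [r] into [((C * r) ^ (1 / alpha)) ^ alpha = C * r]. *)
apply: (@cover_measure_le _ _ _ _ _ _ (fun r => (C * r) `^ alpha^-1)) => //.
- by move=> r; apply: ltW.
- by move=> r r0; rewrite powR_gt0 ?mulr_gt0.
- by move=> r r0; rewrite -powRrM mulVf ?gt_eqF// powRr1// mulr_ge0 ?ltW.
have ai0 : 0 < alpha^-1 by rewrite invr_gt0.
have : C `^ alpha^-1 * r `^ alpha^-1 @[r --> 0^'+] --> C `^ alpha^-1 * 0.
  by apply: cvgM; [exact: cvg_cst|exact: powR_cvg0].
(* The power of [C * r] is split only for [r > 0], which holds near [0^'+]. *)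
rewrite mulr0; apply: cvg_trans; apply: near_eq_cvg.
by near=> r; rewrite powRM ?ltW//; near: r; exact: nbhs_right_gt.
Unshelve. all: by end_near. Qed.
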